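(* Let $G$ be a finite group, let $n$ be a positive integer, let $1\leq p\leq 2$, let $0<\varepsilon\leq 1/16$ and let $f:G\to U(n)$ be an $\varepsilon$-representation with respect to $\|\cdot\|_p'$. Then there exist an integer $m\in[(1-4\varepsilon^p)n,(1-4\varepsilon^p)^{-1}n]$ and an $(n,m)$-partial representation $\rho$ of $G$ such that \[\|f(x)-\rho(x)\|_p'\leq(1+2D_p+8^{1/p})\varepsilon\] for every $x\in G$, where $D_p=1+3\cdot 2^{3/p-1}+2(2^{5-p}+2^{2-p})^{1/p}$.
   Context: For $A\in M_n(\mathbb{C})$ with singular values $\lambda_1,\dots,\lambda_n$, the normalized Schatten $p$-norm is $\|A\|_p'=\left(\frac1n\sum_{i=1}^n\lambda_i^p\right)^{1/p}$. A map $f:G\to U(n)$ is an $\varepsilon$-representation with respect to $\|\cdot\|_p'$ if $\|f(x)f(y)-f(xy)\|_p'\leq\varepsilon$ for all $x,y\in G$. An $n\times m$ complex matrix is a partial unitary matrix if its rows are orthonormal when $n\leq m$ and its columns are orthonormal when $n\geq m$. An $(n,m)$-partial representation of $G$ is a function $\rho:G\to M_n(\mathbb{C})$ of the form $\rho(x)=VP(x)V^*$, where $V$ is an $n\times m$ partial unitary matrix and $P:G\to U(m)$ is a unitary representation. *)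

(* Defs.v *)
From mathcomp Require Import all_boot all_order all_algebra all_fingroup.
From mathcomp Require Import mxrepresentation complex spectral.
From mathcomp Require Import reals exp.

Set Implicit Arguments.
Unset Strict Implicit.
Unset Printing Implicit Defensive.

Import Order.TTheory GRing.Theory Num.Theory.
Local Open Scope ring_scope.
Local Open Scope sesquilinear_scope.

(* [A ^t* *m A] is Hermitian, so its [spectral_diag] lists its eigenvalues with
   multiplicity; they are nonnegative reals, and [singular_value A] lists
   their square roots (see [singular_value_char_poly]). *)
Definition singular_value (R : realType) (n : nat) (A : 'M[R[i]]_n)
    (i : 'I_n) : R :=
  Num.sqrt (complex.Re (spectral_diag (A ^t* *m A) 0 i)).

Definition schatten (R : realType) (n : nat) (p : R) (A : 'M[R[i]]_n) : R :=
  (n%:R^-1 * \sum_(i < n) singular_value A i `^ p) `^ p^-1.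

Definition unitary_on (R : realType) (gT : finGroupType) (G : {group gT})
    (n : nat) (f : gT -> 'M[R[i]]_n) : Prop :=
  forall x, x \in G -> f x \is unitarymx.

Definition eps_representation (R : realType) (gT : finGroupType)
    (G : {group gT}) (n : nat) (p eps : R) (f : gT -> 'M[R[i]]_n) : Prop :=
  unitary_on G f /\
  forall x y, x \in G -> y \in G ->
    schatten p (f x *m f y - f (x * y)%g) <= eps.

(* [unitarymx] on a rectangular matrix says that its rows are orthonormal. *)
Definition partial_unitary (R : realType) (n m : nat)
    (V : 'M[R[i]]_(n, m)) : Prop :=
  ((n <= m)%N -> V \is unitarymx) /\ ((m <= n)%N -> V^T \is unitarymx).

Definition partial_representation (R : realType) (gT : finGroupType)
    (G : {group gT}) (n m : nat) (rho : gT -> 'M[R[i]]_n) : Prop :=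
  exists (V : 'M[R[i]]_(n, m)) (P : mx_representation R[i] G m),
    [/\ partial_unitary V, unitary_on G P &
        forall x, x \in G -> rho x = V *m P x *m V ^t*].

Definition D_const (R : realType) (p : R) : R :=
  1 + 3 * 2 `^ (3 / p - 1) + 2 * (2 `^ (5 - p) + 2 `^ (2 - p)) `^ p^-1.

Lemma singular_valueE (R : realType) (n : nat) (A : 'M[R[i]]_n) (i : 'I_n) :
  (real_complex R (singular_value A i)) ^+ 2 = spectral_diag (A ^t* *m A) 0 i.
Proof.
set B := A ^t* *m A.
have trC k l q (M : 'M[R[i]]_(k, l)) (N : 'M[R[i]]_(l, q)) :
    (M *m N) ^t* = N ^t* *m M ^t* by rewrite trmx_mul map_mxM.
have trCK k l (M : 'M[R[i]]_(k, l)) : (M ^t*) ^t* = M.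
  by apply/matrixP => a b; rewrite !mxE; exact: conjCK.
have nB : B \is normalmx by apply/normalmxP; rewrite /B trC trCK.
set S := spectralmx B.
have uS : S \is unitarymx := spectral_unitarymx B.
have dE : diag_mx (spectral_diag B) = (A *m S ^t*) ^t* *m (A *m S ^t*).
  have /orthomx_spectralP BE := nB; rewrite -/S in BE.
  have SBS : S *m B *m S ^t* = diag_mx (spectral_diag B).
    rewrite {1}BE invmx_unitary // !mulmxA (unitarymxP uS) mul1mx -mulmxA.
    by rewrite (unitarymxP uS) mulmx1.
  by rewrite trC trCK -SBS /B !mulmxA.
have ge0 : 0 <= spectral_diag B 0 i.
  have := congr1 (fun M : 'M[R[i]]_n => M i i) dE.
  rewrite /= [diag_mx _ _ _]mxE eqxx mulr1n => ->.
  by rewrite mxE sumr_ge0 // => k _; rewrite !mxE mulrC mul_conjC_ge0.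
rewrite -rmorphXn /= /singular_value -/B.
case: (spectral_diag B 0 i) ge0 => a b; rewrite lecE /= => /andP[/eqP -> a0].
by rewrite sqr_sqrtr.
Qed.

Lemma singular_value_char_poly (R : realType) (n : nat) (A : 'M[R[i]]_n) :
  char_poly (A ^t* *m A) =
  \prod_(i < n) ('X - ((real_complex R (singular_value A i)) ^+ 2)%:P).
Proof.
have nB : A ^t* *m A \is normalmx.
  apply/normalmxP; suff -> : (A ^t* *m A) ^t* = A ^t* *m A by [].
  rewrite trmx_mul map_mxM; congr (_ *m _).
  by apply/matrixP => a b; rewrite !mxE; exact: conjCK.
rewrite (eq_bigr (fun i => 'X - (spectral_diag (A ^t* *m A) 0 i)%:P)); last first.
  by move=> i _; rewrite singular_valueE.
move: (A ^t* *m A) nB => B nB.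
have /orthomx_spectralP BE := nB.
set S := spectralmx B in BE; set d := spectral_diag B in BE *.
have uS : S \in unitmx := unitarymx_unit (spectral_unitarymx B).
have -> : char_poly B = char_poly (diag_mx d).
  rewrite /char_poly; pose phi (M : 'M[R[i]]_n) := map_mx (@polyC R[i]) M.
  have SS : phi (invmx S) *m phi S = 1%:M.
    by rewrite /phi -map_mxM mulVmx // map_mx1.
  have -> : char_poly_mx B =
      phi (invmx S) *m char_poly_mx (diag_mx d) *m phi S.
    rewrite /phi /char_poly_mx mulmxBr mulmxBl {1}BE !map_mxM.
    by rewrite scalar_mxC -[in RHS](mulmxA _%:M) -!/(phi _) SS mulmx1.
  by rewrite !det_mulmx mulrAC -det_mulmx SS det1 mul1r.
rewrite char_poly_trig ?diag_mx_is_trig //.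
by apply: eq_bigr => i _; rewrite mxE eqxx.
Qed.

(* Main.v *)
(* Stinespring dilation followed by spectral rounding.  With c^2 = 1 / #|G|, the
   isometry u |-> (c f(a) u)_a of C^n into the direct sum of #|G| copies of C^n
   compresses the shift representation P to
   phi(x) = avg_a f(a)^* f(ax), which is eps-close to f by convexity of the p-th
   power of the Schatten norm.  Averaging the projection onto the range of the
   isometry over G yields an operator H with 0 <= H <= 1, trace n and commuting
   with P; since the variance of a |-> f(a)^* f(ax) controls n - ||phi(x)||_2^2,
   tr (H - H^2) <= 2 eps^p n, so that H is close to its spectral projection Q onto
   ]1/2, 1] and the rank m of Q is close to n.  The representation is P restricted
   to the range of Q, and the partial unitary matrix is the polar part of the
   compression of the isometry to that range. *)
Require Import Defs.
From mathcomp Require Import all_boot all_order all_algebra all_fingroup.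
From mathcomp Require Import mxrepresentation complex spectral.
From mathcomp Require Import reals exp.
From mathcomp Require Import ring lra.

Import Order.TTheory GRing.Theory Num.Theory.
Local Open Scope ring_scope.

Set Implicit Arguments.
Unset Strict Implicit.
Unset Printing Implicit Defensive.
Local Open Scope sesquilinear_scope.
Local Notation "x %:C" := (real_complex _ x) (format "x %:C") : ring_scope.

(** * Conjugate transposes and unitary matrices *)

Section Adjoint.
Variable C : numClosedFieldType.

Lemma adjmxM k l q (M : 'M[C]_(k, l)) (N : 'M[C]_(l, q)) :
  (M *m N) ^t* = N ^t* *m M ^t*.
Proof. by rewrite trmx_mul map_mxM. Qed.

Lemma adjmxD k l (M N : 'M[C]_(k, l)) : (M + N) ^t* = M ^t* + N ^t*.
Proof. by rewrite linearD /= map_mxD. Qed.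

Lemma adjmxB k l (M N : 'M[C]_(k, l)) : (M - N) ^t* = M ^t* - N ^t*.
Proof. by rewrite linearB /= map_mxB. Qed.

Lemma adjmxE k l (M : 'M[C]_(k, l)) i j : (M ^t*) i j = (M j i)^*.
Proof. by rewrite !mxE. Qed.

Lemma adjmx1 k : (1%:M : 'M[C]_k) ^t* = 1%:M.
Proof. by rewrite trmx1 map_mx1. Qed.

Lemma unitarymx_adj n (M : 'M[C]_n) : M \is unitarymx -> M ^t* *m M = 1%:M.
Proof. by move=> uM; rewrite -invmx_unitary // mulVmx ?unitarymx_unit. Qed.

Lemma unitarymx_adj_unitary n (M : 'M[C]_n) :
  M \is unitarymx -> M ^t* \is unitarymx.
Proof. by rewrite trmxC_unitary. Qed.

Lemma mxtrace_adj n (M : 'M[C]_n) : \tr (M ^t*) = (\tr M)^*.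
Proof. by rewrite /mxtrace rmorph_sum; apply: eq_bigr => i _; rewrite adjmxE. Qed.

End Adjoint.

(** * Hilbert-Schmidt geometry, contractions and real diagonal matrices *)

Section HilbertSchmidt.
Variable R : realType.
Local Notation C := R[i].

(** The norm of [R[i]] takes its values in [R[i]]; this real-valued form is the one to which [powR]
    applies. *)
Definition cabs (z : C) : R := complex.Re `|z|.

Lemma cabsE z : (cabs z)%:C = `|z|.
Proof. by rewrite RRe_real // normr_real. Qed.

Lemma cabs_ge0 z : 0 <= cabs z.
Proof. by rewrite -ler0c cabsE. Qed.

Lemma cabsM z w : cabs (z * w) = cabs z * cabs w.
Proof. by apply: complexI; rewrite rmorphM /= !cabsE normrM. Qed.

Lemma cabs0 : cabs 0 = 0.
Proof. by apply: complexI; rewrite cabsE normr0. Qed.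

Lemma cabs_real (x : R) : 0 <= x -> cabs x%:C = x.
Proof. by move=> x0; apply: complexI; rewrite cabsE ger0_norm ?ler0c. Qed.

Lemma cabs_sum (I : finType) (F : I -> C) :
  cabs (\sum_i F i) <= \sum_i cabs (F i).
Proof.
rewrite -lecR cabsE rmorph_sum /=; apply: le_trans (ler_norm_sum _ _ _) _.
by apply: ler_sum => i _; rewrite cabsE.
Qed.

Lemma cabs_conj z : cabs z^* = cabs z.
Proof. by apply: complexI; rewrite !cabsE norm_conjC. Qed.

(** Taking the real part turns the Hilbert-Schmidt inner product into a symmetric real form; [hs2]
    is the squared Frobenius norm, not divided by the dimension. *)
Definition hsdot k l (A B : 'M[C]_(k, l)) : R := complex.Re (\tr (A *m B ^t*)).
Definition hs2 k l (A : 'M[C]_(k, l)) : R := hsdot A A.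

Lemma real_gramE k l (B : 'M[C]_(k, l)) i :
  (B *m B ^t*) i i = (\sum_j cabs (B i j) ^+ 2)%:C.
Proof.
rewrite rmorph_sum mxE; apply: eq_bigr => j _.
by rewrite rmorphXn /= cabsE adjmxE normCK.
Qed.

Lemma hs2E k l (A : 'M[C]_(k, l)) : hs2 A = \sum_i \sum_j cabs (A i j) ^+ 2.
Proof.
apply: complexI; rewrite /hs2 /hsdot rmorph_sum /=.
have -> : \tr (A *m A ^t*) = \sum_i (\sum_j cabs (A i j) ^+ 2)%:C.
  by apply: eq_bigr => i _; rewrite real_gramE.
by rewrite -rmorph_sum.
Qed.

Lemma mxtrace_gram k l (B : 'M[C]_(k, l)) : \tr (B *m B ^t*) = (hs2 B)%:C.
Proof. by rewrite hs2E rmorph_sum; apply: eq_bigr => i _; rewrite real_gramE. Qed.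

Lemma hs2_ge0 k l (A : 'M[C]_(k, l)) : 0 <= hs2 A.
Proof. by rewrite hs2E; do 2!apply: sumr_ge0 => ? _; rewrite exprn_ge0 ?cabs_ge0. Qed.

Lemma hsdotBl k l (A B D : 'M[C]_(k, l)) : hsdot (A - B) D = hsdot A D - hsdot B D.
Proof. by rewrite /hsdot mulmxBl raddfB raddfB. Qed.

Lemma hsdotC k l (A B : 'M[C]_(k, l)) : hsdot A B = hsdot B A.
Proof.
have Re_conj (z : C) : complex.Re z^* = complex.Re z by case: z.
by rewrite /hsdot -[LHS]Re_conj -mxtrace_adj adjmxM trmxCK.
Qed.

Lemma hsdotBr k l (A B D : 'M[C]_(k, l)) : hsdot D (A - B) = hsdot D A - hsdot D B.
Proof. by rewrite hsdotC hsdotBl !(hsdotC D). Qed.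

Lemma hs2B k l (A B : 'M[C]_(k, l)) : hs2 (A - B) = hs2 A + hs2 B - 2 * hsdot A B.
Proof. rewrite /hs2 hsdotBl !hsdotBr (hsdotC B A); ring. Qed.

Lemma hsdot_le k l (A B : 'M[C]_(k, l)) : hsdot A B <= (hs2 A + hs2 B) / 2.
Proof. have := hs2_ge0 (A - B); rewrite hs2B; lra. Qed.

Lemma hs2_adj k l (A : 'M[C]_(k, l)) : hs2 (A ^t*) = hs2 A.
Proof.
rewrite !hs2E exchange_big; apply: eq_bigr => i _; apply: eq_bigr => j _.
by rewrite adjmxE cabs_conj.
Qed.

Lemma hsdot_adj k l q (A : 'M[C]_(k, l)) (B : 'M[C]_(k, q)) (X : 'M[C]_(q, l)) :
  hsdot A (B *m X) = hsdot (A *m X ^t*) B.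
Proof. by rewrite /hsdot adjmxM mulmxA. Qed.

Lemma hs2_unitary k l (A : 'M[C]_(k, l)) : A \is unitarymx -> hs2 A = k%:R.
Proof. by move=> /unitarymxP uA; rewrite /hs2 /hsdot uA mxtrace1 raddfMn. Qed.

(** Equivalent to operator norm at most 1, but phrased with [hs2] alone. The free number of rows [q]
    covers single row vectors as well as whole matrices. *)
Definition contraction k l (X : 'M[C]_(k, l)) : Prop :=
  forall q (A : 'M[C]_(q, k)), hs2 (A *m X) <= hs2 A.

Lemma contractionM k l q (X : 'M[C]_(k, l)) (Y : 'M[C]_(l, q)) :
  contraction X -> contraction Y -> contraction (X *m Y).
Proof. by move=> cX cY r A; rewrite mulmxA; exact: le_trans (cY _ _) (cX _ _). Qed.

(** With [B := A *m X ^t*], [hs2 B] is the inner product of [B *m X] and [A], hence at most half of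
    [hs2 B + hs2 A]; absorbing [hs2 B] on the left concludes. *)
Lemma contraction_adj k l (X : 'M[C]_(k, l)) : contraction X -> contraction (X ^t*).
Proof.
move=> cX q A; set B := A *m X ^t*.
have : hs2 B = hsdot (B *m X) A by rewrite -[X in B *m X]trmxCK -hsdot_adj.
have := hsdot_le (B *m X) A; have := cX _ B; lra.
Qed.

Lemma hs2_mull k l q (X : 'M[C]_(k, l)) (A : 'M[C]_(l, q)) :
  contraction X -> hs2 (X *m A) <= hs2 A.
Proof.
move=> cX; rewrite -hs2_adj adjmxM -(hs2_adj A).
exact: (contraction_adj cX).
Qed.

Lemma contraction_unitary k l (X : 'M[C]_(k, l)) : X \is unitarymx -> contraction X.
Proof.
move=> uX q A; rewrite /hs2 /hsdot adjmxM mulmxA mulmxtVK //.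
Qed.

Lemma contraction_row k l (X : 'M[C]_(k, l)) i :
  contraction X -> \sum_j cabs (X i j) ^+ 2 <= 1.
Proof.
move=> /(_ _ (delta_mx 0 i : 'rV_k)); rewrite -rowE !hs2E !big_ord1.
under eq_bigr do rewrite mxE.
move/le_trans; apply; rewrite (bigD1 i) //= big1 => [|j ji].
  by rewrite addr0 !mxE !eqxx -(cabs_real ler01) cabs_real // expr1n.
by rewrite !mxE (negPf ji) andbF cabs0 expr0n.
Qed.

Lemma contraction_col k l (X : 'M[C]_(k, l)) j :
  contraction X -> \sum_i cabs (X i j) ^+ 2 <= 1.
Proof.
move=> /contraction_adj/contraction_row -/(_ j); apply: le_trans.
by apply: ler_sum => i _; rewrite adjmxE cabs_conj.
Qed.

Lemma contraction_cabs_le1 k l (X : 'M[C]_(k, l)) i j :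
  contraction X -> cabs (X i j) <= 1.
Proof.
move=> /(contraction_row i) X1.
rewrite -[_ <= 1]ler_sqr ?nnegrE ?cabs_ge0 // expr1n; apply: le_trans X1.
by rewrite (bigD1 j) //= lerDl sumr_ge0 // => ? _; rewrite exprn_ge0 ?cabs_ge0.
Qed.

Definition rdiag n (t : 'I_n -> R) : 'M[C]_n := diag_mx (\row_i (t i)%:C).

Lemma rdiag_adj n (t : 'I_n -> R) : (rdiag t) ^t* = rdiag t.
Proof.
rewrite /rdiag tr_diag_mx map_diag_mx; congr diag_mx; apply/rowP => i.
by rewrite !mxE; apply: conj_Creal; apply/complex_realP; eexists.
Qed.

Lemma rdiagM n (s t : 'I_n -> R) : rdiag s *m rdiag t = rdiag (fun i => s i * t i).
Proof.
by rewrite mulmx_diag; congr diag_mx; apply/rowP => i; rewrite !mxE rmorphM.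
Qed.

Lemma eq_rdiag n (s t : 'I_n -> R) : s =1 t -> rdiag s = rdiag t.
Proof. by move=> st; congr diag_mx; apply/rowP => i; rewrite !mxE st. Qed.

Lemma rdiagB n (s t : 'I_n -> R) : rdiag s - rdiag t = rdiag (fun i => s i - t i).
Proof.
by rewrite /rdiag -linearB; congr diag_mx; apply/rowP => i; rewrite !mxE rmorphB.
Qed.

Lemma rdiag1 n : rdiag (fun _ : 'I_n => 1) = 1%:M.
Proof. by apply/matrixP => i j; rewrite !mxE. Qed.

Lemma mxtrace_rdiag k (t : 'I_k -> R) : \tr (rdiag t) = (\sum_i t i)%:C.
Proof. by rewrite mxtrace_diag rmorph_sum; apply: eq_bigr => i _; rewrite mxE. Qed.

Lemma cabs_mulmx_diag_le k l q (X : 'M[C]_(q, k)) (t : 'I_k -> R)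
    (Y : 'M[C]_(k, l)) i j :
  cabs ((X *m rdiag t *m Y) i j) <=
  \sum_a (cabs (X i a) ^+ 2 + cabs (Y a j) ^+ 2) / 2 * `|t a|.
Proof.
rewrite mxE; apply: le_trans (cabs_sum _) _; apply: ler_sum => a _.
rewrite mul_mx_diag !mxE !cabsM mulrAC ler_pM // ?mulr_ge0 ?cabs_ge0 //.
  have := sqr_ge0 (cabs (X i a) - cabs (Y a j)); rewrite sqrrB; nra.
by rewrite /cabs normc_def /= expr0n addr0 sqrtr_sqr.
Qed.

End HilbertSchmidt.

(** * Singular value decomposition of rectangular matrices *)

Section SingularValues.
Variable R : realType.
Local Notation C := R[i].

(* The zero rows of [M] are replaced one at a time by a unit vector orthogonal to
   all rows, which exists as long as the rank of [M] is less than [k <= m]. *)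
Lemma orthonormal_completion k m (M : 'M[C]_(k, m)) (e : pred 'I_k) :
  (k <= m)%N -> M *m M ^t* = diag_mx (\row_i (e i)%:R) ->
  exists2 B : 'M[C]_(k, m), B \is unitarymx & diag_mx (\row_i (e i)%:R) *m B = M.
Proof.
move=> km; have [r] := ubnP #|[pred i | ~~ e i]|.
elim: r => // r IH in e M *; rewrite ltnS => er MM.
have row0 i : ~~ e i -> row i M = 0.
  move=> /negPf ei; apply/rowP => j; rewrite !mxE.
  have /matrixP/(_ i i) := MM; rewrite !mxE eqxx ei mulr1n => /eqP.
  rewrite psumr_eq0 => [|a _]; last by rewrite !mxE mul_conjC_ge0.
  move=> /allP/(_ j (mem_index_enum _)); rewrite !mxE mul_conjC_eq0.
  by move=> /eqP.
case: (pickP [pred i | ~~ e i]) => [i0 /= ei0|eT]; last first.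
  have E1 : diag_mx (\row_i (e i)%:R) = 1%:M :> 'M[C]_k.
    apply/matrixP => i j; rewrite !mxE; have /= := eT i.
    by case: (e i).
  by exists M; rewrite ?E1 ?mul1mx //; apply/unitarymxP; rewrite MM.
have rM : (\rank M < k)%N.
  rewrite ltn_neqAle rank_leq_row andbT; apply/negP => fM.
  have : (delta_mx 0 i0 : 'rV[C]_k) *m M == 0 by rewrite -rowE row0.
  rewrite mulmx_free_eq0 // => /eqP/matrixP/(_ 0 i0) /eqP.
  by rewrite !mxE !eqxx oner_eq0.
pose v := nz_row (kermx (M ^t*)).
have v0 : v != 0.
  rewrite nz_row_eq0 -mxrank_eq0 mxrank_ker mxrank_map mxrank_tr subn_eq0 -ltnNge.
  exact: leq_trans rM km.
have vM : v *m M ^t* = 0 by apply/sub_kermxP; exact: nz_row_sub.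
have vv : v *m v ^t* = ((hs2 v)%:C)%:M.
  rewrite [LHS]mx11_scalar; congr (_%:M); rewrite hs2E big_ord1 rmorph_sum mxE.
  by apply: eq_bigr => j _; rewrite rmorphXn /= cabsE adjmxE normCK.
have hv : 0 < hs2 v.
  rewrite lt0r hs2_ge0 andbT; apply: contra v0 => /eqP hv0.
  apply/eqP/rowP => j; move/matrixP/(_ 0 0): vv; rewrite hv0 !mxE.
  move=> /eqP; rewrite mul0rn.
  rewrite psumr_eq0 => [|a _]; last by rewrite adjmxE mul_conjC_ge0.
  by move=> /allP/(_ j (mem_index_enum _)); rewrite adjmxE mul_conjC_eq0 => /eqP.
pose c : C := ((Num.sqrt (hs2 v))^-1)%:C.
pose w := c *: v.
have ww : w *m w ^t* = 1%:M.
  rewrite /w linearZ /= map_mxZ -scalemxAl -scalemxAr scalerA vv scale_scalar_mx.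
  have cC : c^* = c by apply: conj_Creal; apply/complex_realP; eexists.
  rewrite /= cC.
  rewrite -!rmorphM -expr2 exprVn sqr_sqrtr ?hs2_ge0 // mulVf ?gt_eqF //.

have wM : w *m M ^t* = 0 by rewrite -scalemxAl vM scaler0.
have Mw : M *m w ^t* = 0 by rewrite -[M]trmxCK -adjmxM wM trmx0 map_mx0.
pose e' := [pred i | (i == i0) || e i].
have diagE : diag_mx (\row_i (e' i)%:R) =
    diag_mx (\row_i (e i)%:R) + delta_mx i0 i0 :> 'M[C]_k.
  apply/matrixP => i j; rewrite !mxE /=; have [->|ij] := eqVneq i j; last first.
    by case: (i =P i0) ij => [->|_]; rewrite ?(eq_sym j) ?addr0 //= => /negPf ->;
      rewrite addr0.
  by rewrite !mulr1n; case: eqP => [->|_]; rewrite ?(negPf ei0) ?add0r ?addr0.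
pose M' := M + delta_mx i0 0 *m w.
have [] := IH e' M'.
- apply: leq_trans er; apply: proper_card; apply/properP; split.
    by apply/subsetP => i; rewrite !inE negb_or => /andP[].
  by exists i0; rewrite !inE ?eqxx.
- rewrite diagE -MM /M' adjmxD mulmxDl !mulmxDr adjmxM -!mulmxA wM mulmx0 add0r.
  rewrite (mulmxA w) ww mul1mx (mulmxA M) Mw mul0mx addr0; congr (_ + _).
  apply/matrixP => i j; rewrite !mxE big_ord1 !mxE !eqxx !andbT.
  by rewrite conjC_nat -natrM mulnb.
move=> B uB BM; exists B => //.
have -> : diag_mx (\row_i (e i)%:R) =
    diag_mx (\row_i (e i)%:R) *m diag_mx (\row_i (e' i)%:R) :> 'M[C]_k.
  rewrite mulmx_diag; congr diag_mx; apply/rowP => i; rewrite !mxE /=.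
  by rewrite -natrM mulnb; case: (e i); rewrite ?orbT ?andbF.
rewrite -mulmxA BM mulmxDr mulmxA.
have -> : diag_mx (\row_i (e i)%:R) *m delta_mx i0 0 = 0 :> 'M[C]_(k, 1).
  apply/matrixP => i j; rewrite mul_diag_mx !mxE.
  by case: eqP => [->|_]; rewrite ?(negPf ei0) ?mul0r ?mulr0.
rewrite mul0mx addr0; apply/matrixP => i j; rewrite mul_diag_mx !mxE.
case: (boolP (e i)) => [_|/row0/rowP/(_ j)]; first by rewrite mul1r.
by rewrite !mxE mul0r.
Qed.


(** The rectangular version of [singular_value], convertible with it on square matrices. *)
Definition sv m n (T : 'M[C]_(m, n)) (i : 'I_n) : R :=
  Num.sqrt (complex.Re (spectral_diag (T ^t* *m T) 0 i)).

Lemma gram_spectral m n (T : 'M[C]_(m, n)) :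
  let A := T *m (spectralmx (T ^t* *m T)) ^t* in
  A ^t* *m A = rdiag (fun i => sv T i ^+ 2).
Proof.
set B := T ^t* *m T; set S := spectralmx B => A.
have uS : S \is unitarymx := spectral_unitarymx B.
have nB : B \is normalmx by apply/normalmxP; rewrite /B adjmxM trmxCK.
have dE : A ^t* *m A = diag_mx (spectral_diag B).
  have /orthomx_spectralP BE := nB; rewrite -/S in BE.
  rewrite /A adjmxM trmxCK -!mulmxA (mulmxA (T ^t*)) -/B {1}BE invmx_unitary //.
  by rewrite !mulmxA (unitarymxP uS) mul1mx -mulmxA (unitarymxP uS) mulmx1.
rewrite dE; congr diag_mx; apply/rowP => i; rewrite mxE rmorphXn /= /sv -/B.
have : 0 <= spectral_diag B 0 i.
  have := congr1 (fun M : 'M[C]_n => M i i) dE.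
  rewrite /= [diag_mx _ _ _]mxE eqxx mulr1n => <-.
  by rewrite mxE sumr_ge0 // => k _; rewrite adjmxE mulrC mul_conjC_ge0.
case: (spectral_diag B 0 i) => a b; rewrite lecE /= => /andP[/eqP -> a0].
by rewrite -rmorphXn /= sqr_sqrtr.
Qed.

Lemma sv_ge0 m n (T : 'M[C]_(m, n)) i : 0 <= sv T i.
Proof. exact: sqrtr_ge0. Qed.

(** In an eigenbasis of the Gram matrix the columns of [T] become orthogonal, of lengths [sv T i].
    The nonzero ones are normalized and the family is completed to an orthonormal one, for which
    [n <= m] leaves room. *)
Theorem svd m n (T : 'M[C]_(m, n)) : (n <= m)%N ->
  exists L : 'M[C]_(m, n), exists S : 'M[C]_n,
  [/\ L ^t* \is unitarymx, S \is unitarymx & T = L *m rdiag (sv T) *m S].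
Proof.
move=> nm; have := gram_spectral T; set S := spectralmx _.
have uS : S \is unitarymx := spectral_unitarymx _.
set A := T *m S ^t* => /= AA.
have TA : A *m S = T by rewrite mulmxKtV.
clearbody A.
(* Since the inverse of 0 is 0, scaling by [s'] yields zero rows where the singular value vanishes,
   as [orthonormal_completion] expects. *)
pose e i := sv T i != 0; pose s' i := (sv T i)^-1.
have [B uB BA] : exists2 B : 'M[C]_(n, m), B \is unitarymx &
    diag_mx (\row_i (e i)%:R) *m B = rdiag s' *m A ^t*.
  apply: orthonormal_completion => //.
  rewrite adjmxM trmxCK rdiag_adj mulmxA -(mulmxA (rdiag _)) AA !rdiagM.
  congr diag_mx; apply/rowP => i; rewrite !mxE /s' /e.
  rewrite -[(_ != 0)%:R](rmorph_nat (real_complex R)).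
  congr (_%:C); case: eqP => [->|/eqP s0]; first by rewrite invr0 !mulr0.
  by rewrite expr2 mulKf // divff.
exists (B ^t*), S; split=> //; first by rewrite trmxCK.
suff -> : B ^t* *m rdiag (sv T) = A by [].
rewrite -[LHS]trmxCK adjmxM trmxCK rdiag_adj -[RHS]trmxCK; congr (_ ^t*).
have -> : rdiag (sv T) = rdiag (sv T) *m diag_mx (\row_i (e i)%:R).
  rewrite mulmx_diag; congr diag_mx; apply/rowP => i; rewrite !mxE /e.
  by case: eqP => [->|_]; rewrite ?mulr0 ?mulr1.
rewrite -mulmxA BA mulmxA rdiagM; apply/matrixP => i j.
rewrite mul_diag_mx [in LHS]mxE [(\row__ _) _ _]mxE /s'.
have [s0|s0] := eqVneq (sv T i) 0; last by rewrite divff // rmorph1 mul1r.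
(* A zero singular value kills the whole column of [A], whose squared length is the diagonal entry
   of [AA]. *)
rewrite s0 mul0r mul0r; apply/esym; rewrite adjmxE.
have /matrixP/(_ i i) := AA; rewrite !mxE eqxx mulr1n s0 expr0n /= => /eqP.
rewrite psumr_eq0 => [|a _]; last by rewrite !mxE mulrC mul_conjC_ge0.
move=> /allP/(_ j (mem_index_enum _)); rewrite adjmxE mulrC mul_conjC_eq0 => /eqP ->.
by rewrite rmorph0.
Qed.

End SingularValues.

(** * Powers of Schatten norms: variational formula, convexity, comparison with the Frobenius
    norm *)

Section SchattenSum.
Variable R : realType.
Local Notation C := R[i].

(** The p-th power lies above its tangent at [a]: this is Young's inequality with exponents [p] and
    [p / (p - 1)], so [p = 1] is treated apart. *)
Lemma powR_tangent (p a t : R) : 1 <= p -> 0 <= a -> 0 <= t ->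
  p * a `^ (p - 1) * t <= t `^ p + (p - 1) * a `^ p.
Proof.
rewrite le_eqVlt => /predU1P[<- a0 t0|p1 a0 t0].
  by rewrite subrr powRr0 powRr1 // mul0r addr0 !mul1r.
have p0 : 0 < p by lra.
have p10 : 0 < p - 1 by lra.
have pn : p != 0 by rewrite gt_eqF.
have p1n : p - 1 != 0 by rewrite gt_eqF.
have := @conjugate_powR _ t (a `^ (p - 1)) p (p / (p - 1)) t0 (powR_ge0 _ _) p0.
rewrite divr_gt0 // => /(_ isT).
have -> : p^-1 + (p / (p - 1))^-1 = 1 by field; rewrite pn p1n.
move=> /(_ erefl); rewrite -powRrM.
have -> : (p - 1) * (p / (p - 1)) = p by field.
rewrite -(ler_pM2l p0) => /le_trans le; rewrite -mulrA [_ * t]mulrC; apply: le.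
by rewrite le_eqVlt; apply/orP; left; apply/eqP; field; rewrite pn p1n.
Qed.

(* Total weight at most 1 suffices, because x `^ p vanishes at 0. *)
Lemma powR_jensen (I : finType) (w t : I -> R) (p : R) : 1 <= p ->
  (forall i, 0 <= w i) -> \sum_i w i <= 1 -> (forall i, 0 <= t i) ->
  (\sum_i w i * t i) `^ p <= \sum_i w i * t i `^ p.
Proof.
move=> p1 w0 w1 t0; set a := \sum_i _.
have a0 : 0 <= a by apply: sumr_ge0 => i _; rewrite mulr_ge0.
(* The tangent inequality is averaged at the weighted mean [a]. *)
have : \sum_i w i * (p * a `^ (p - 1) * t i) <=
       \sum_i w i * (t i `^ p + (p - 1) * a `^ p).
  by apply: ler_sum => i _; rewrite ler_wpM2l ?powR_tangent.
have -> : \sum_i w i * (p * a `^ (p - 1) * t i) = p * a `^ p.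
  rewrite -(@mulr_powRB1 _ a p a0) ?(lt_le_trans _ p1) //.
  rewrite [a * _]mulrC mulrA.
  transitivity (p * a `^ (p - 1) * \sum_i w i * t i); last by [].
  rewrite mulr_sumr.
  by apply: eq_bigr => i _; rewrite mulrCA.
under [X in _ <= X -> _]eq_bigr do rewrite mulrDr.
rewrite big_split /= -mulr_suml.
have : (\sum_i w i) * ((p - 1) * a `^ p) <= (p - 1) * a `^ p.
  by rewrite ler_piMl // mulr_ge0 ?powR_ge0 // subr_ge0.
by set s := \sum_i _; set s2 := \sum_i _; lra.
Qed.

(** Each diagonal entry is bounded by a weighted sum of the [|t a|]. As [X] and [Y] are
    contractions, the weights [w i a] have total at most 1 over [a], which permits Jensen's
    inequality, and over [i], which bounds the resulting double sum. *)
Lemma sum_diag_powR_le q k (p : R) (X : 'M[C]_(q, k)) (t : 'I_k -> R)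
    (Y : 'M[C]_(k, q)) : 1 <= p -> contraction X -> contraction Y ->
  \sum_i cabs ((X *m rdiag t *m Y) i i) `^ p <= \sum_a `|t a| `^ p.
Proof.
move=> p1 cX cY; have p0 : 0 <= p by lra.
pose w i a := (cabs (X i a) ^+ 2 + cabs (Y a i) ^+ 2) / 2.
have w0 i a : 0 <= w i a by rewrite divr_ge0 // addr_ge0 // exprn_ge0 ?cabs_ge0.
apply: (@le_trans _ _ (\sum_i \sum_a w i a * `|t a| `^ p)).
  apply: ler_sum => i _.
  apply: (@le_trans _ _ ((\sum_a w i a * `|t a|) `^ p)).
    apply: ge0_ler_powR; rewrite ?nnegrE ?cabs_ge0 ?cabs_mulmx_diag_le //.
    by apply: sumr_ge0 => a _; rewrite mulr_ge0.
  apply: powR_jensen => //; rewrite -mulr_suml big_split /=.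
  have := contraction_row i cX; have := contraction_col i cY; lra.
rewrite exchange_big; apply: ler_sum => a _ /=; rewrite -mulr_suml.
rewrite ler_piMl ?powR_ge0 // -mulr_suml big_split /=.
have := contraction_row a cY; have := contraction_col a cX; lra.
Qed.

(** For [p >= 1] this is [n] times the p-th power of [schatten p A]; estimates are made on it to
    avoid roots. *)
Definition schatten_sum n (p : R) (A : 'M[C]_n) : R :=
  \sum_(i < n) singular_value A i `^ p.

Lemma schatten_sum_ge0 n (p : R) (A : 'M[C]_n) : 0 <= schatten_sum p A.
Proof. by apply: sumr_ge0 => i _; rewrite powR_ge0. Qed.

Lemma svd_square n (A : 'M[C]_n) : exists L S : 'M[C]_n,
  [/\ L \is unitarymx, S \is unitarymx & A = L *m rdiag (singular_value A) *m S].
Proof.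
have [L [S [uL uS AE]]] := svd A (leqnn n).
exists L, S; split; [by rewrite -trmxC_unitary | exact: uS | exact: AE].
Qed.

Lemma singular_value_attained n (A : 'M[C]_n) : exists X Y : 'M[C]_n,
  [/\ contraction X, contraction Y & X *m A *m Y = rdiag (singular_value A)].
Proof.
have [L [S [uL uS AE]]] := svd_square A.
exists (L ^t*), (S ^t*); split.
- exact/contraction_adj/contraction_unitary.
- exact/contraction_adj/contraction_unitary.
- move: AE; move: (rdiag _) => D ->.
  by rewrite !mulmxA unitarymx_adj // mul1mx mulmxtVK.
Qed.

Lemma singular_value_ge0 n (A : 'M[C]_n) i : 0 <= singular_value A i.
Proof. exact: sqrtr_ge0. Qed.

Lemma schatten_sum_attained n (A : 'M[C]_n) : exists X Y : 'M[C]_n,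
  [/\ contraction X, contraction Y &
   forall i, singular_value A i = cabs ((X *m A *m Y) i i)].
Proof.
have [X [Y [cX cY E]]] := singular_value_attained A.
exists X, Y; split=> // i.
by rewrite E !mxE eqxx mulr1n cabs_real // singular_value_ge0.
Qed.

Lemma schatten_sum_rdiag_le n k (p : R) (X : 'M[C]_(n, k)) (t : 'I_k -> R)
    (Y : 'M[C]_(k, n)) : 1 <= p -> contraction X -> contraction Y ->
  schatten_sum p (X *m rdiag t *m Y) <= \sum_a `|t a| `^ p.
Proof.
move=> p1 cX cY; have [X1 [Y1 [cX1 cY1 E]]] := schatten_sum_attained (X *m rdiag t *m Y).
rewrite /schatten_sum; under eq_bigr do rewrite E -!mulmxA mulmxA mulmxA.
exact: (sum_diag_powR_le t p1 (contractionM cX1 cX) (contractionM cY cY1)).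
Qed.

(** The singular value decomposition reduces this to [sum_diag_powR_le]. Together with
    [schatten_sum_attained] it presents [schatten_sum p A] as a maximum over contractions, whence
    the ideal property and convexity. *)
Lemma schatten_sum_diag_ge n (p : R) (A X Y : 'M[C]_n) : 1 <= p ->
  contraction X -> contraction Y ->
  \sum_i cabs ((X *m A *m Y) i i) `^ p <= schatten_sum p A.
Proof.
move=> p1 cX cY; have [L [S [uL uS AE]]] := svd_square A.
rewrite [A in X in X <= _]AE; under eq_bigr do rewrite -!mulmxA mulmxA mulmxA.
apply: le_trans (sum_diag_powR_le _ p1 _ _) _.
- exact/contractionM/contraction_unitary.
- exact/contractionM/cY/contraction_unitary.
by apply: ler_sum => i _; rewrite ger0_norm ?singular_value_ge0.
Qed.

Lemma schatten_sumM_le n (p : R) (A X Y : 'M[C]_n) : 1 <= p ->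
  contraction X -> contraction Y ->
  schatten_sum p (X *m A *m Y) <= schatten_sum p A.
Proof.
move=> p1 cX cY; have [X1 [Y1 [cX1 cY1 E]]] := schatten_sum_attained (X *m A *m Y).
rewrite {1}/schatten_sum; under eq_bigr do rewrite E -!mulmxA mulmxA mulmxA.
exact: (schatten_sum_diag_ge A p1 (contractionM cX1 cX) (contractionM cY cY1)).
Qed.

(** Contractions attaining the value at the weighted sum reduce the claim to Jensen's inequality for
    each diagonal entry. *)
Lemma schatten_sum_convex n (p : R) (I : finType) (w : I -> R) (A : I -> 'M[C]_n) :
  1 <= p -> (forall i, 0 <= w i) -> \sum_i w i <= 1 ->
  schatten_sum p (\sum_i (w i)%:C *: A i) <= \sum_i w i * schatten_sum p (A i).
Proof.
move=> p1 w0 w1; set B := \sum_i _.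
have [X [Y [cX cY E]]] := schatten_sum_attained B.
apply: (@le_trans _ _ (\sum_a \sum_i w i * cabs ((X *m A i *m Y) a a) `^ p)).
  apply: ler_sum => a _; rewrite E.
  apply: le_trans (powR_jensen p1 w0 w1 (fun=> cabs_ge0 _)).
  apply: ge0_ler_powR; rewrite ?nnegrE ?cabs_ge0 //; first by lra.
    by apply: sumr_ge0 => i _; rewrite mulr_ge0 ?cabs_ge0.
  rewrite /B mulmx_sumr mulmx_suml summxE; apply: le_trans (cabs_sum _) _.
  apply: ler_sum => i _.
  by rewrite -scalemxAr -scalemxAl mxE cabsM cabs_real.
rewrite exchange_big; apply: ler_sum => i _; rewrite -mulr_sumr.
by rewrite ler_wpM2l // schatten_sum_diag_ge.
Qed.

(** Singular values of the product are at most 1, so their p-th powers are at most themselves; as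
    diagonal entries of a product they are then bounded by AM-GM. *)
Lemma schatten_sum_factor_le n N (p : R) (X : 'M[C]_(n, N)) (Y : 'M[C]_(N, n)) :
  1 <= p -> contraction X -> contraction Y ->
  schatten_sum p (X *m Y) <= (hs2 X + hs2 Y) / 2.
Proof.
move=> p1 cX cY; have [X1 [Y1 [cX1 cY1 E]]] := schatten_sum_attained (X *m Y).
have c1 : contraction (X1 *m X) by exact: contractionM.
have c2 : contraction (Y *m Y1) by exact: contractionM.
have le1 : hs2 (X1 *m X) <= hs2 X by apply: hs2_mull.
have le2 : hs2 (Y *m Y1) <= hs2 Y by apply: cY1.
apply: (@le_trans _ _ ((hs2 (X1 *m X) + hs2 (Y *m Y1)) / 2)); last by lra.
rewrite -[hs2 (Y *m Y1)]hs2_adj !hs2E -big_split /= mulr_suml.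
apply: ler_sum => i _; rewrite E mulmxA -mulmxA.
set x := cabs _; have x0 : 0 <= x by exact: cabs_ge0.
have x1 : x <= 1 by apply/contraction_cabs_le1/contractionM.
have /le_trans : x `^ p <= x.
  have [->|xn] := eqVneq x 0; first by rewrite powR0 //; lra.
  by rewrite ge1r_powR // x1 lt0r xn x0.
apply; rewrite /x.
have := cabs_mulmx_diag_le (X1 *m X) (fun=> 1) (Y *m Y1) i i.
rewrite rdiag1 mulmx1 => /le_trans; apply.
rewrite -big_split /= mulr_suml; apply: ler_sum => a _.
by rewrite adjmxE cabs_conj normr1 mulr1.
Qed.

Lemma sum_singular_value_sqr n (A : 'M[C]_n) :
  \sum_i singular_value A i ^+ 2 = hs2 A.
Proof.
have [L [S [uL uS AE]]] := svd_square A.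
have -> : hs2 A = hs2 (rdiag (singular_value A)).
  move: AE; move: (rdiag _) => D ->.
  rewrite {1}/hs2 hsdot_adj mulmxtVK // -/(hs2 _) -hs2_adj adjmxM.
  by rewrite {1}/hs2 hsdot_adj trmxCK -mulmxA unitarymx_adj // mulmx1 -/(hs2 _) hs2_adj.
rewrite hs2E; apply: eq_bigr => i _; rewrite (bigD1 i) //= big1 => [|j ji].
  by rewrite !mxE eqxx mulr1n cabs_real ?singular_value_ge0 // addr0.
by rewrite !mxE eq_sym (negPf ji) mulr0n cabs0 expr0n.
Qed.

Lemma singular_value_le2 n (A B : 'M[C]_n) i :
  contraction A -> contraction B -> singular_value (A - B) i <= 2.
Proof.
move=> cA cB; have [X [Y [cX cY ->]]] := schatten_sum_attained (A - B).
rewrite mulmxBr mulmxBl -lecR cabsE !mxE; apply: le_trans (ler_normB _ _) _.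
rewrite -!cabsE -rmorphD lecR.
have := contraction_cabs_le1 i i (contractionM (contractionM cX cA) cY).
have := contraction_cabs_le1 i i (contractionM (contractionM cX cB) cY).
by rewrite ![(_ *m _) i i]mxE; lra.
Qed.

(** A singular value [s] of [A - B] lies in [[0, 2]]. If [s <= 1], its square is at most its p-th
    power since [p <= 2]; otherwise its square is at most [2 * s], and [s] is at most its p-th
    power. *)
Lemma hs2_le_schatten_sum n (p : R) (A B : 'M[C]_n) : 1 <= p -> p <= 2 ->
  contraction A -> contraction B -> hs2 (A - B) <= 2 * schatten_sum p (A - B).
Proof.
move=> p1 p2 cA cB; rewrite -sum_singular_value_sqr mulr_sumr.
apply: ler_sum => i _; have := singular_value_le2 i cA cB.
have := singular_value_ge0 (A - B) i; move: (singular_value _ _) => s s0 s2.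
have [s1|s1] := leP s 1.
  have [->|sn] := eqVneq s 0; first by rewrite expr0n mulr_ge0 ?powR_ge0.
  have : s `^ 2 <= s `^ p by apply: ger_powR => //; rewrite lt0r sn s0.
  by rewrite powR_mulrn //; have := powR_ge0 s p; lra.
by have := @le1r_powR _ s p (ltW s1) p1; nra.
Qed.

End SchattenSum.

(** * The Stinespring dilation of [f] *)

Section Dilation.
Variables (R : realType) (gT : finGroupType) (G : {group gT}) (n : nat).
Variable f : gT -> 'M[R[i]]_n.
Local Notation C := R[i].
Local Notation N := #|{: 'I_n * gT}|.

(** Indices range over all of [gT], not only [G], so that translation by any [x] is a permutation
    and no membership conditions arise. *)
Definition shift (x : gT) (k : 'I_N) : 'I_N :=
  enum_rank ((enum_val k).1, ((enum_val k).2 * x)%g).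

Lemma shift_inj x : injective (shift x).
Proof.
move=> k l /enum_rank_inj [e1 /mulIg e2]; apply: enum_val_inj.
by rewrite [LHS]surjective_pairing e1 e2 -surjective_pairing.
Qed.

Definition shift_perm x : 'S_N := perm (@shift_inj x).

Lemma shift_permM x y : shift_perm (x * y)%g = (shift_perm x * shift_perm y)%g.
Proof. by apply/permP => k; rewrite permM !permE /shift enum_rankK mulgA. Qed.

Lemma shift_perm1 : shift_perm 1%g = 1%g.
Proof.
by apply/permP => k; rewrite !permE /shift mulg1 -surjective_pairing enum_valK.
Qed.

Definition shift_mx x : 'M[C]_N := perm_mx (shift_perm x).

Lemma shift_mx_unitary x : shift_mx x \is unitarymx.
Proof.
apply/unitarymxP; rewrite tr_perm_mx map_perm_mx -perm_mxM mulgV perm_mx1 //.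
Qed.

Let c : C := (Num.sqrt (#|G|%:R^-1))%:C.

(** The adjoint of the isometry sending [u] to the family of the [c f(a) u], with zero blocks at [a]
    outside [G]. *)
Definition dilation_mx : 'M[C]_(n, N) :=
  \matrix_(j, k) (if (enum_val k).2 \in G
                  then c * (f (enum_val k).2 (enum_val k).1 j)^* else 0).

Lemma dilation_mxE x : x \in G ->
  dilation_mx *m shift_mx x *m dilation_mx ^t* =
  #|G|%:R^-1 *: \sum_(a in G) (f a) ^t* *m f (a * x)%g.
Proof.
move=> xG; have cc : c * c^* = #|G|%:R^-1.
  have -> : c^* = c by apply: conj_Creal; apply/complex_realP; eexists.
  rewrite -rmorphM -expr2 sqr_sqrtr ?invr_ge0 ?ler0n //.
  by rewrite fmorphV rmorph_nat.
rewrite -mulmxA -row_permE; apply/matrixP => j l; rewrite mxE.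
rewrite (reindex enum_rank) /=; last exact/onW_bij/enum_rank_bij.
rewrite mxE summxE mulr_sumr.
under [RHS]eq_bigr do rewrite mxE mulr_sumr.
rewrite exchange_big pair_big /= big_mkcond [RHS]big_mkcond /=.
(* For [x] in [G], [a * x] lies in [G] exactly when [a] does, so the two support conditions
   coincide. *)
apply: eq_bigr => -[i a] _; rewrite !mxE permE /shift !enum_rankK /= groupMr //.
case: ifP => _; last by rewrite mul0r.
rewrite [X in _ * X]rmorphM [X in _ * (_ * X)]conjCK -cc; ring.
Qed.

Lemma dilation_mx_unitary : unitary_on G f -> dilation_mx \is unitarymx.
Proof.
move=> uf; apply/unitarymxP; have := dilation_mxE (group1 G).
rewrite /shift_mx shift_perm1 perm_mx1 mulmx1 => ->.
under eq_bigr => a aG do rewrite mulg1 unitarymx_adj ?uf //.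
by rewrite sumr_const -(scaler_nat _ 1%:M) scalerA mulVf ?scale1r // pnatr_eq0 -lt0n cardG_gt0.
Qed.

End Dilation.

(** * The group average of the range projection and its commutant *)

Section AverageOperator.
Variables (C : numClosedFieldType) (gT : finGroupType) (G : {group gT}) (n N : nat).
Variables (P : gT -> 'M[C]_N) (V : 'M[C]_(n, N)).
Hypothesis uP : forall x, P x \is unitarymx.
Hypothesis PM : forall x y, P (x * y)%g = P x *m P y.

Definition avg_op : 'M[C]_N :=
  #|G|%:R^-1 *: \sum_(x in G) (P x *m V ^t*) *m (P x *m V ^t*) ^t*.

Lemma avg_op_comm g : g \in G -> P g *m avg_op = avg_op *m P g.
Proof.
move=> gG; rewrite -scalemxAr -scalemxAl; congr (_ *: _).
rewrite mulmx_sumr mulmx_suml [RHS](reindex_inj (mulgI g)) /=.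
apply: eq_big => [x|x xG]; first by rewrite groupMl.
rewrite PM !adjmxM trmxCK -!mulmxA; do 4!congr (_ *m _).
by rewrite unitarymx_adj ?mulmx1.
Qed.

Lemma card_mulV : #|G|%:R^-1 * #|G|%:R = 1 :> C.
Proof. by rewrite mulVf // pnatr_eq0 -lt0n cardG_gt0. Qed.

(** By cyclicity of the trace, an [M] commuting with [P x] undoes the conjugation by [P x], so all
    terms of the average are equal. *)
Lemma mxtrace_avg_op (M : 'M[C]_N) : (forall x, x \in G -> P x *m M = M *m P x) ->
  \tr (M *m avg_op) = \tr (V *m M *m V ^t*).
Proof.
move=> MP; rewrite -scalemxAr mxtraceZ mulmx_sumr raddf_sum /=.
rewrite (eq_bigr (fun=> \tr (V *m M *m V ^t*))) => [|x xG].
  by rewrite sumr_const -(mulr_natl (\tr _)) mulrA card_mulV mul1r.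
rewrite adjmxM trmxCK !mulmxA -MP // mxtrace_mulC !mulmxA unitarymx_adj // mul1mx.
by rewrite mxtrace_mulC mulmxA.
Qed.

Lemma avg_op_adj : avg_op ^t* = avg_op.
Proof.
rewrite /avg_op linearZ /= map_mxZ; congr (_ *: _).
  by rewrite fmorphV /= conjC_nat.
rewrite linear_sum /= map_mx_sum; apply: eq_bigr => x _.
by rewrite adjmxM trmxCK.
Qed.

Lemma mxtrace_avg_op_sqr : \tr (avg_op *m avg_op) =
  #|G|%:R^-1 * \sum_(x in G) \tr (V *m P x *m V ^t* *m (V *m P x *m V ^t*) ^t*).
Proof.
rewrite (mxtrace_avg_op avg_op_comm).
rewrite -scalemxAr -scalemxAl mxtraceZ mulmx_sumr mulmx_suml raddf_sum /=.
by congr (_ * _); apply: eq_bigr => x _; rewrite !adjmxM trmxCK !mulmxA.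
Qed.

Lemma avg_op_conj (S : 'M[C]_N) : S *m avg_op *m S ^t* =
  #|G|%:R^-1 *: \sum_(x in G) (S *m P x *m V ^t*) *m (S *m P x *m V ^t*) ^t*.
Proof.
rewrite -scalemxAr -scalemxAl mulmx_sumr mulmx_suml; congr (_ *: _).
by apply: eq_bigr => x _; rewrite !adjmxM trmxCK !mulmxA.
Qed.

Lemma spectral_conj (H : 'M[C]_N) : H ^t* = H ->
  spectralmx H *m H *m (spectralmx H) ^t* = diag_mx (spectral_diag H).
Proof.
move=> HH; have nH : H \is normalmx by apply/normalmxP; rewrite HH.
have uS : spectralmx H \is unitarymx := spectral_unitarymx H.
have /orthomx_spectralP HE := nH.
rewrite {2}HE invmx_unitary // !mulmxA (unitarymxP uS) mul1mx -mulmxA.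
by rewrite (unitarymxP uS) mulmx1.
Qed.

(** In the eigenbasis, commuting with [diag_mx d] forces the entry [i, j] of [X] to vanish unless
    [d 0 i = d 0 j]; then [q] agrees at [i] and [j] too. *)
Lemma comm_spectral_projection (S : 'M[C]_N) (d q : 'rV[C]_N) (X H : 'M[C]_N) :
  S \is unitarymx -> S *m H *m S ^t* = diag_mx d -> X *m H = H *m X ->
  (forall i j, d 0 i = d 0 j -> q 0 i = q 0 j) ->
  X *m (S ^t* *m diag_mx q *m S) = S ^t* *m diag_mx q *m S *m X.
Proof.
move=> uS SH XH dq; have SS := unitarymx_adj uS; have /unitarymxP SS' := uS.
pose Y := S *m X *m S ^t*.
have YD : Y *m diag_mx d = diag_mx d *m Y.
  rewrite -SH /Y !mulmxA; transitivity (S *m (X *m H) *m S ^t*).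
    by rewrite -!mulmxA (mulmxA (S ^t*) S) SS mul1mx.
  by rewrite XH -!mulmxA (mulmxA (S ^t*) S) SS mul1mx.
have YQ : Y *m diag_mx q = diag_mx q *m Y.
  apply/matrixP => i j; rewrite mul_mx_diag mul_diag_mx mxE [RHS]mxE.
  have /matrixP/(_ i j) := YD; rewrite mul_mx_diag mul_diag_mx mxE [RHS]mxE.
  rewrite mulrC => /eqP; rewrite -subr_eq0 -mulrBl mulf_eq0 subr_eq0.
  case/orP => [/eqP/dq ->|/eqP Y0]; first by rewrite mulrC.
  by rewrite Y0 mulr0 mul0r.
have XE : X = S ^t* *m Y *m S.
  by rewrite /Y !mulmxA SS mul1mx -mulmxA SS mulmx1.
clearbody Y; rewrite XE -!mulmxA (mulmxA S (S ^t*)) SS' mul1mx (mulmxA S (S ^t*)) SS' mul1mx.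
by rewrite (mulmxA Y) YQ !mulmxA.
Qed.

End AverageOperator.

(** * Rounding the averaged operator to a spectral projection *)

Section Rounding.
Variables (R : realType) (gT : finGroupType) (G : {group gT}) (n N : nat).
Local Notation C := R[i].
Variables (P : gT -> 'M[C]_N) (V : 'M[C]_(n, N)).
Hypothesis uP : forall x, P x \is unitarymx.
Hypothesis PM : forall x y, P (x * y)%g = P x *m P y.
Hypothesis uV : V \is unitarymx.

Local Notation H := (avg_op G P V).
Local Notation S := (spectralmx H).

(** The eigenvalues are given as averages of squared row norms, from which their bounds and their
    sum can be read off; [avg_op_diag] justifies the name. *)
Definition avg_eigenvalue (i : 'I_N) : R :=
  #|G|%:R^-1 * \sum_(x in G) \sum_j cabs ((S *m P x *m V ^t*) i j) ^+ 2.

Lemma avg_op_diag : S *m H *m S ^t* = rdiag avg_eigenvalue.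
Proof.
have HS := spectral_conj (avg_op_adj G P V).
rewrite HS; congr diag_mx; apply/rowP => i; rewrite [RHS]mxE.
have /matrixP/(_ i i) := HS; rewrite avg_op_conj [X in _ = X]mxE eqxx mulr1n => <-.
rewrite mxE summxE /avg_eigenvalue rmorphM fmorphV rmorph_nat; congr (_ * _).
by rewrite rmorph_sum; apply: eq_bigr => x _; rewrite real_gramE.
Qed.

Let uS : S \is unitarymx := spectral_unitarymx H.

Lemma card_groupR_gt0 : 0 < #|G|%:R :> R.
Proof. by rewrite ltr0n cardG_gt0. Qed.

Lemma avg_eigenvalue_ge0 i : 0 <= avg_eigenvalue i.
Proof.
rewrite mulr_ge0 ?invr_ge0 ?ler0n //.
by do 2!apply: sumr_ge0 => ? _; rewrite exprn_ge0 ?cabs_ge0.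
Qed.

Lemma avg_eigenvalue_le1 i : avg_eigenvalue i <= 1.
Proof.
rewrite /avg_eigenvalue mulrC ler_pdivrMr ?card_groupR_gt0 // mul1r.
rewrite -sumr_const; apply: ler_sum => x _; apply: contraction_row.
exact: (contractionM (contraction_unitary (mul_unitarymx uS (uP x)))
                     (contraction_adj (contraction_unitary uV))).
Qed.

Lemma sum_avg_eigenvalue : \sum_i avg_eigenvalue i = n%:R.
Proof.
rewrite -mulr_sumr exchange_big /= (eq_bigr (fun=> n%:R)) => [|x _].
  by rewrite sumr_const -(mulr_natl n%:R) mulKf // gt_eqF ?card_groupR_gt0.
rewrite -hs2E -hs2_adj adjmxM trmxCK; apply: hs2_unitary.
exact: (mul_unitarymx uV (unitarymx_adj_unitary (mul_unitarymx uS (uP x)))).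
Qed.

Lemma sum_avg_eigenvalue_sqr : \sum_i avg_eigenvalue i ^+ 2 =
  #|G|%:R^-1 * \sum_(x in G) hs2 (V *m P x *m V ^t*).
Proof.
apply: complexI; rewrite -mxtrace_rdiag.
transitivity (\tr (rdiag avg_eigenvalue *m rdiag avg_eigenvalue)).
  by rewrite rdiagM; congr (\tr _); apply: eq_rdiag => i; rewrite expr2.
rewrite -avg_op_diag -!mulmxA (mulmxA (S ^t*)) unitarymx_adj // mul1mx.
rewrite mxtrace_mulC -!mulmxA unitarymx_adj // mulmx1 (mxtrace_avg_op_sqr G V uP PM).
rewrite rmorphM fmorphV rmorph_nat rmorph_sum; congr (_ * _).
by apply: eq_bigr => x _; rewrite mxtrace_gram.
Qed.

(** The adjoints of the rows of [W] are the eigenvectors with eigenvalue above 1/2, so [W ^t* *m W]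
    is the spectral projection and [q] its diagonal in the eigenbasis. *)
Let big : pred 'I_N := [pred i | 1 / 2 < avg_eigenvalue i].
Let W : 'M[C]_(#|big|, N) := rowsub (@enum_val _ big) S.
Let q i : R := (i \in big)%:R.

Lemma big_rows_unitary : W \is unitarymx.
Proof.
apply/unitarymxP/matrixP => a b; have /unitarymxP/matrixP := uS.
move=> /(_ (enum_val a) (enum_val b)); rewrite !mxE (inj_eq enum_val_inj) => <-.
by apply: eq_bigr => j _; rewrite !mxE.
Qed.

Lemma big_rows_projection : W ^t* *m W = S ^t* *m rdiag q *m S.
Proof.
apply/matrixP => i j; rewrite [LHS]mxE [RHS]mxE.
transitivity (\sum_(k in big) (S k i)^* * S k j).
  by rewrite [RHS]big_enum_val; apply: eq_bigr => a _; rewrite adjmxE !mxE.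
rewrite big_mkcond; apply: eq_bigr => k _; rewrite mul_mx_diag mxE adjmxE.
rewrite [X in _ * X * _]mxE /q.
by case: ifP => _; rewrite ?rmorph1 ?rmorph0 ?mulr1 ?mulr0 ?mul0r.
Qed.

Lemma big_rows_comm x : x \in G -> P x *m (W ^t* *m W) = W ^t* *m W *m P x.
Proof.
move=> xG; rewrite big_rows_projection.
apply: (comm_spectral_projection uS avg_op_diag); first exact: avg_op_comm.
move=> i j; rewrite !mxE => /complexI hij.
by rewrite /q !inE hij.
Qed.

(** The left side is the trace of the projection compressed by [V]; as the projection commutes with
    [P], [mxtrace_avg_op] turns it into the trace of its product with [H]. *)
Lemma hs2_big_rows : hs2 (V *m W ^t*) = \sum_i q i * avg_eigenvalue i.
Proof.
apply: complexI; rewrite -mxtrace_gram adjmxM trmxCK mulmxA -(mulmxA V).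
rewrite -(mxtrace_avg_op V uP big_rows_comm) big_rows_projection.
rewrite mxtrace_mulC !mulmxA mxtrace_mulC !mulmxA avg_op_diag rdiagM mxtrace_rdiag.
by congr (_%:C); apply: eq_bigr => i _; rewrite mulrC.
Qed.

(** The quantity in the last bound is the sum of [|q i - l|] over the eigenvalues [l] of [H]. It is
    compared with the sum of [l - l ^+ 2], which is the mean over [G] of the defects bounded by
    [kappa]. *)
Lemma spectral_rounding (kappa : R) :
  (forall x, x \in G -> n%:R - hs2 (V *m P x *m V ^t*) <= kappa) ->
  exists m (W : 'M[C]_(m, N)), [/\ W \is unitarymx,
    forall x, x \in G -> P x *m (W ^t* *m W) = W ^t* *m W *m P x &
    n%:R + m%:R - 2 * hs2 (V *m W ^t*) <= 2 * kappa].
Proof.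
move=> le; exists #|big|, W; split; [exact: big_rows_unitary|exact: big_rows_comm|].
have -> : #|big|%:R = \sum_i q i.
  by rewrite -sum1_card natr_sum big_mkcond; apply: eq_bigr => i _; rewrite /q; case: ifP.
rewrite hs2_big_rows -sum_avg_eigenvalue -big_split /= mulr_sumr -sumrB.
(* The cut at 1/2 is used here: [l <= 2 * l * (1 - l)] below it, and [1 - l <= 2 * l * (1 - l)]
   above it. *)
apply: (@le_trans _ _ (2 * \sum_i (avg_eigenvalue i - avg_eigenvalue i ^+ 2))).
  rewrite mulr_sumr; apply: ler_sum => i _; rewrite /q inE.
  have := avg_eigenvalue_ge0 i; have := avg_eigenvalue_le1 i.
  by case: ltP; rewrite /=; nra.
rewrite ler_pM2l // sumrB sum_avg_eigenvalue sum_avg_eigenvalue_sqr.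
have {1}-> : n%:R = #|G|%:R^-1 * \sum_(x in G) n%:R :> R.
  by rewrite sumr_const -(mulr_natl n%:R) mulKf // gt_eqF ?card_groupR_gt0.
rewrite -mulrBr -sumrB mulrC ler_pdivrMr ?card_groupR_gt0 // mulr_natr.
by rewrite -sumr_const; apply: ler_sum => x xG; exact: le.
Qed.

End Rounding.

(** * Polar parts and the quasi-triangle inequality *)

Section Polar.
Variable R : realType.
Local Notation C := R[i].

Lemma hs2_mul_unitary k l q (A : 'M[C]_(k, l)) (B : 'M[C]_(l, q)) :
  B \is unitarymx -> hs2 (A *m B) = hs2 A.
Proof. by move=> uB; rewrite /hs2 hsdot_adj mulmxtVK. Qed.

Lemma hs2_rdiag n (t : 'I_n -> R) : hs2 (rdiag t) = \sum_i t i ^+ 2.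
Proof.
apply: complexI; rewrite -mxtrace_gram rdiag_adj rdiagM mxtrace_rdiag.
by congr (_%:C); apply: eq_bigr => i _; rewrite expr2.
Qed.

Lemma partial_unitary_wide n m (U : 'M[C]_(n, m)) : (n <= m)%N ->
  U \is unitarymx -> partial_unitary U.
Proof.
move=> nm uU; split=> // mn; have E : m = n by apply/eqP; rewrite eqn_leq nm mn.
by case: _ / E U uU => U uU; rewrite trmx_unitary.
Qed.

Lemma partial_unitary_tall n m (U : 'M[C]_(n, m)) : (m <= n)%N ->
  U ^t* \is unitarymx -> partial_unitary U.
Proof.
rewrite conjC_unitary => mn uU; split=> // nm.
have E : m = n by apply/eqP; rewrite eqn_leq nm mn.
by case: _ / E U uU => U uU; rewrite -trmx_unitary.
Qed.

(** [svd] handles tall matrices; a wide [T] is treated through its adjoint. The product [A *m B] is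
    the polar part. *)
Lemma polar_decomposition n m (T : 'M[C]_(n, m)) :
  exists (A : 'M[C]_(n, minn n m)) (B : 'M[C]_(minn n m, m)) (t : 'I_(minn n m) -> R),
  [/\ A ^t* \is unitarymx, B \is unitarymx, partial_unitary (A *m B),
      forall i, 0 <= t i & T = A *m rdiag t *m B].
Proof.
case: (leqP n m) => [nm|/ltnW mn].
  have [L [S [uL uS TE]]] := svd (T ^t*) nm.
  exists (S ^t*), (L ^t*), (sv (T ^t*)); split.
  - by rewrite trmxCK.
  - exact: uL.
  - exact: partial_unitary_wide nm (mul_unitarymx (unitarymx_adj_unitary uS) uL).
  - by move=> i; exact: sv_ge0.
  - by rewrite -[LHS]trmxCK {1}TE !adjmxM rdiag_adj mulmxA.
have [L [S [uL uS TE]]] := svd T mn.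
exists L, S, (sv T); split; [exact: uL|exact: uS| |by move=> i; exact: sv_ge0|exact: TE].
apply: partial_unitary_tall mn _; rewrite adjmxM.
exact: mul_unitarymx (unitarymx_adj_unitary uS) uL.
Qed.

(** Each [t i] is a diagonal entry of a contraction, hence lies in [[0, 1]], where the p-th power of
    [1 - t i] is at most [1 - t i], and so at most [1 - t i ^+ 2]. *)
Lemma polar_defect n m k (p : R) (A : 'M[C]_(n, k)) (B : 'M[C]_(k, m)) (t : 'I_k -> R) :
  1 <= p -> A ^t* \is unitarymx -> B \is unitarymx -> (forall i, 0 <= t i) ->
  contraction (A *m rdiag t *m B) ->
  \sum_i `|t i - 1| `^ p <= k%:R - hs2 (A *m rdiag t *m B).
Proof.
move=> p1 uA uB t0 cT.
have t1 i : t i <= 1.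
  have c1 := contractionM (contractionM (contraction_unitary uA) cT)
                          (contraction_adj (contraction_unitary uB)).
  have := contraction_cabs_le1 i i c1; rewrite -!mulmxA (unitarymxP uB) mulmx1.
  have /unitarymxP := uA; rewrite trmxCK mulmxA => ->; rewrite mul1mx.
  by rewrite !mxE eqxx mulr1n cabs_real.
have -> : hs2 (A *m rdiag t *m B) = \sum_i t i ^+ 2.
  rewrite hs2_mul_unitary // -hs2_adj adjmxM (hs2_mul_unitary _ uA) hs2_adj.
  exact: hs2_rdiag.
have -> : k%:R = \sum_(i < k) 1 :> R by rewrite sumr_const card_ord.
rewrite -sumrB; apply: ler_sum => i _.
rewrite -normrN opprB ger0_norm ?subr_ge0 //; have := t0 i; have := t1 i.
move: (t i) => s s1 s0.
apply: (@le_trans _ _ (1 - s)); last by rewrite expr2; nra.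
have [->|sn] := eqVneq (1 - s) 0; first by rewrite powR0 // gt_eqF // (lt_le_trans _ p1).
by rewrite ge1r_powR // lt0r sn subr_ge0 s1 /= lerBlDr lerDl.
Qed.

Lemma schatten_sumZ n (p c : R) (A : 'M[C]_n) : 1 <= p -> 0 <= c ->
  schatten_sum p (c%:C *: A) <= c `^ p * schatten_sum p A.
Proof.
move=> p1 c0; have [L [S [uL uS AE]]] := svd_square A.
have -> : c%:C *: A = L *m rdiag (fun i => c * singular_value A i) *m S.
  move: AE; rewrite -(rdiagM (fun=> c)); move: (rdiag (singular_value A)) => D ->.
  have -> : rdiag (fun=> c) = (c%:C)%:M :> 'M[C]_n.
    by apply/matrixP => i j; rewrite !mxE.
  by rewrite mulmxA scalar_mxC !scalemxAl mul_scalar_mx -!scalemxAl.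
apply: le_trans (schatten_sum_rdiag_le _ p1 _ _) _; try exact: contraction_unitary.
rewrite mulr_sumr; apply: ler_sum => i _.
by rewrite ger0_norm ?mulr_ge0 ?singular_value_ge0 // powRM ?singular_value_ge0.
Qed.

(** The sum is twice a midpoint: convexity gives the factor 1/2 and homogeneity the power of 2. *)
Lemma schatten_sumD n (p : R) (A B : 'M[C]_n) : 1 <= p ->
  schatten_sum p (A + B) <= 2 `^ p / 2 * (schatten_sum p A + schatten_sum p B).
Proof.
move=> p1; have -> : A + B = 2%:C *: \sum_(b : bool) (2^-1 : R)%:C *: (if b then A else B).
  rewrite big_bool /= -scalerDr scalerA -rmorphM divff ?pnatr_eq0 //.
  by rewrite rmorph1 scale1r.
apply: le_trans (schatten_sumZ _ p1 _) _ => //; rewrite -mulrA ler_wpM2l ?powR_ge0 //.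
apply: le_trans (schatten_sum_convex _ p1 _ _) _ => //.
- by rewrite invr_ge0.
- by rewrite big_bool /= -[2^-1]mul1r -splitr.
- by rewrite big_bool /= mulrDr.
Qed.

End Polar.

(** * Errors of compressing to the range of the projection and of passing to the polar part *)

Section Compression.
Variables (R : realType) (n m N : nat) (p : R).
Local Notation C := R[i].
Variables (V : 'M[C]_(n, N)) (W : 'M[C]_(m, N)) (X : 'M[C]_N).
Hypothesis p1 : 1 <= p.
Hypothesis uV : V \is unitarymx.
Hypothesis uW : W \is unitarymx.
Hypothesis uX : X \is unitarymx.
Hypothesis XW : X *m (W ^t* *m W) = W ^t* *m W *m X.
Local Notation T := (V *m W ^t*).

Lemma hs2_compl_projection k (A : 'M[C]_(k, N)) :
  hs2 (A *m (1%:M - W ^t* *m W)) = hs2 A - hs2 (A *m W ^t*).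
Proof.
rewrite mulmxBr mulmx1 hs2B mulmxA (hs2_mul_unitary _ uW) hsdot_adj -/(hs2 _).
by ring.
Qed.

Lemma contraction_compl_projection : contraction (1%:M - W ^t* *m W).
Proof. by move=> k A; rewrite hs2_compl_projection lerBlDr lerDl hs2_ge0. Qed.

(** With [Z := 1%:M - W ^t* *m W], which commutes with [X], the difference factors through [Z]
    twice, as [V *m Z] times [Z *m X *m V ^t*]. Both factors are contractions with [hs2] at most
    [n%:R - hs2 T]. *)
Lemma schatten_sum_compression_le :
  schatten_sum p (V *m X *m V ^t* - T *m (W *m X *m W ^t*) *m T ^t*)
    <= n%:R - hs2 T.
Proof.
set Q := W ^t* *m W; set Z : 'M[C]_N := 1%:M - Q.
have QQ : Q *m Q = Q by rewrite /Q mulmxA mulmxtVK.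
have ZZ : Z *m Z = Z.
  by rewrite /Z mulmxBl mul1mx mulmxBr mulmx1 QQ subrr subr0.
have XQ : X *m Q = Q *m X := XW.
have XZ : X *m Z = Z *m X by rewrite /Z mulmxBr mulmxBl mulmx1 mul1mx XQ.
have -> : V *m X *m V ^t* - T *m (W *m X *m W ^t*) *m T ^t* =
    V *m Z *m (Z *m X *m V ^t*).
  have -> : T *m (W *m X *m W ^t*) *m T ^t* = V *m (Q *m X *m Q) *m V ^t*.
    by rewrite /Q adjmxM trmxCK !mulmxA.
  have -> : Q *m X *m Q = Q *m X by rewrite -mulmxA XQ mulmxA QQ.
  rewrite -mulmxBl -mulmxBr; have -> : X - Q *m X = Z *m X.
    by rewrite /Z mulmxBl mul1mx.
  by rewrite -{1}ZZ !mulmxA.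
have cZ := contraction_compl_projection; rewrite -/Q -/Z in cZ.
have cV := contraction_unitary uV; have cX := contraction_unitary uX.
have le1 : hs2 (V *m Z) = n%:R - hs2 T.
  by rewrite hs2_compl_projection hs2_unitary.
have le2 : hs2 (Z *m X *m V ^t*) <= n%:R - hs2 T.
  rewrite -XZ -mulmxA -le1 -[hs2 (V *m Z)]hs2_adj adjmxM.
  have -> : Z ^t* = Z by rewrite /Z adjmxB adjmx1 /Q adjmxM trmxCK.
  exact: hs2_mull.
apply: le_trans (schatten_sum_factor_le p1 (contractionM cV cZ)
  (contractionM (contractionM cZ cX) (contraction_adj cV))) _.
by rewrite le1; lra.
Qed.

(** With [U := A *m B], the difference is [(T - U) Y] times the adjoint of [T], plus [U Y] times the
    adjoint of [T - U]; and [T - U] is [A *m D *m B], with [D] the diagonal of the [t i - 1]. *)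
Lemma schatten_sum_polar_le k (A : 'M[C]_(n, k)) (B : 'M[C]_(k, m)) (t : 'I_k -> R)
    (Y : 'M[C]_m) :
  A ^t* \is unitarymx -> B \is unitarymx -> contraction Y ->
  T = A *m rdiag t *m B ->
  schatten_sum p (T *m Y *m T ^t* - (A *m B) *m Y *m (A *m B) ^t*)
    <= 2 `^ p * \sum_i `|t i - 1| `^ p.
Proof.
move=> uA uB cY TE; pose D := rdiag (fun i => t i - 1).
have TU : T - A *m B = A *m D *m B.
  by rewrite TE /D -rdiagB rdiag1 mulmxBr mulmx1 mulmxBl.
have cA : contraction A by rewrite -[A]trmxCK; exact/contraction_adj/contraction_unitary.
have cB := contraction_unitary uB.
have cT : contraction T := contractionM (contraction_unitary uV)
  (contraction_adj (contraction_unitary uW)).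
have -> : T *m Y *m T ^t* - (A *m B) *m Y *m (A *m B) ^t* =
  A *m D *m (B *m Y *m T ^t*) + A *m B *m Y *m B ^t* *m D *m A ^t*.
  have -> : A *m B *m Y *m B ^t* *m D *m A ^t* =
            A *m B *m Y *m (A *m D *m B) ^t*.
    by rewrite !adjmxM rdiag_adj !mulmxA.
  have -> : A *m D *m (B *m Y *m T ^t*) = (A *m D *m B) *m Y *m T ^t*.
    by rewrite !mulmxA.
  move: (A *m D *m B) TU => M <-; rewrite adjmxB mulmxBr !mulmxBl.
  by rewrite addrA subrK.
apply: le_trans (schatten_sumD _ _ p1) _.
have le1 : schatten_sum p (A *m D *m (B *m Y *m T ^t*)) <= \sum_i `|t i - 1| `^ p.
  exact: schatten_sum_rdiag_le p1 cA
    (contractionM (contractionM cB cY) (contraction_adj cT)).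
have le2 : schatten_sum p (A *m B *m Y *m B ^t* *m D *m A ^t*) <= \sum_i `|t i - 1| `^ p.
  exact: schatten_sum_rdiag_le p1 (contractionM (contractionM (contractionM cA cB) cY)
    (contraction_adj cB)) (contraction_adj cA).
move: le1 le2 (powR_ge0 2 p); move: (schatten_sum p _) (schatten_sum p _).
by move: (\sum_i _) (2 `^ p) => s c a b; nra.
Qed.

End Compression.

(** * Variance bound and numerical constants *)

Section Final.
Variable R : realType.
Local Notation C := R[i].

Lemma schatten_le_sum n (p c : R) (A : 'M[C]_n) : (0 < n)%N -> 1 <= p -> 0 <= c ->
  (schatten p A <= c) = (schatten_sum p A <= n%:R * c `^ p).
Proof.
move=> n0 p1 c0; have p0 : 0 < p by lra.
have n0R : 0 < n%:R :> R by rewrite ltr0n.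
have s0 := schatten_sum_ge0 p A.
have x0 : 0 <= n%:R^-1 * schatten_sum p A by rewrite mulr_ge0 ?invr_ge0 ?ler0n.
rewrite -ler_pdivrMl // /schatten -/(schatten_sum p A).
have powK y : 0 <= y -> (y `^ p^-1) `^ p = y.
  by move=> y0; rewrite -powRrM mulVf ?gt_eqF // powRr1.
have powK' y : 0 <= y -> (y `^ p) `^ p^-1 = y.
  by move=> y0; rewrite -powRrM mulfV ?gt_eqF // powRr1.
apply/idP/idP => le.
  rewrite -[X in X <= _]powK //.
  by apply: ge0_ler_powR; rewrite ?nnegrE ?powR_ge0 ?(ltW p0).
rewrite -[X in _ <= X]powK' //.
by apply: ge0_ler_powR; rewrite ?nnegrE ?powR_ge0 ?invr_ge0 ?(ltW p0).
Qed.

Lemma hsdot_suml (I : finType) (B : pred I) k l (c : R) (F : I -> 'M[C]_(k, l)) D :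
  hsdot (c%:C *: \sum_(i in B) F i) D = c * \sum_(i in B) hsdot (F i) D.
Proof.
rewrite /hsdot -scalemxAl mxtraceZ mulmx_suml raddf_sum /=.
have -> (z : C) : complex.Re (c%:C * z) = c * complex.Re z.
  by case: z => a b /=; rewrite mul0r subr0.
by rewrite raddf_sum.
Qed.

(** The mean of [hs2 (F - g a)] is [2 * n%:R - 2 * hsdot M F] for the average [M], and
    [2 * hsdot M F] is at most [hs2 M + n%:R]: the variance is at most the second moment about
    [F]. *)
Lemma hs2_variance (gT : finGroupType) (G : {group gT}) n (g : gT -> 'M[C]_n)
    (F : 'M[C]_n) (kappa : R) :
  (forall a, a \in G -> g a \is unitarymx) -> F \is unitarymx ->
  (forall a, a \in G -> hs2 (F - g a) <= kappa) ->
  n%:R - hs2 ((#|G|%:R^-1 : R)%:C *: \sum_(a in G) g a) <= kappa.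
Proof.
move=> ug uF le; set M := _ *: _.
have := hsdot_le M F; rewrite (hs2_unitary uF) /M hsdot_suml -/M => leM.
have gG := card_groupR_gt0 R G.
have sum_le : \sum_(a in G) hs2 (F - g a) <= \sum_(a in G) kappa by exact: ler_sum.
have : \sum_(a in G) hs2 (F - g a) =
    \sum_(a in G) (2 * n%:R) - 2 * \sum_(a in G) hsdot (g a) F.
  rewrite mulr_sumr -sumrB; apply: eq_bigr => a aG.
  by rewrite hs2B (hs2_unitary uF) (hs2_unitary (ug a aG)) hsdotC; ring.
have cst (c : R) : \sum_(a in G) c = c * #|G|%:R by rewrite sumr_const mulr_natr.
rewrite !cst in sum_le *; move: sum_le => /[swap] ->; move: leM.
set s := \sum_(a in G) _; set h := hs2 M; move: gG; set c : R := #|G|%:R.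
move=> c0 leM le2; rewrite -(ler_pM2r c0).
have : c^-1 * s * c = s by rewrite mulrAC mulVf ?gt_eqF // mul1r.
nra.
Qed.

(** Two uses of [schatten_sumD] produce the squared factor; the 9 collects the three error terms,
    and 9/4 is at most its p-th power. *)
Lemma sum4_const_le (p : R) : 1 <= p -> 2 `^ p / 2 * (2 `^ p / 2) * 9 <= 9 `^ p.
Proof.
move=> p1; have E4 : 2 `^ p * 2 `^ p = 4 `^ p :> R.
  by rewrite -powRM //; have -> : 2 * 2 = 4 :> R by lra.
have E9 : 9 `^ p = 4 `^ p * (9 / 4) `^ p :> R.
  by rewrite -powRM ?divr_ge0 //; have -> : 4 * (9 / 4) = 9 :> R by lra.
have le : 9 / 4 <= (9 / 4) `^ p :> R by apply: le1r_powR => //; lra.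
have p4 : 0 <= 4 `^ p :> R by exact: powR_ge0.
rewrite E9; have -> : 2 `^ p / 2 * (2 `^ p / 2) * 9 = 2 `^ p * 2 `^ p * (9 / 4) :> R by field.
by rewrite E4 ler_wpM2l.
Qed.

(** As [3 / p >= 1], the first two terms of [D_const p] already give at least 4. *)
Lemma nine_le_const (p : R) : 1 <= p -> p <= 2 ->
  9 <= 1 + 2 * D_const p + 8 `^ p^-1.
Proof.
move=> p1 p2; have e : 0 <= 3 / p - 1 by rewrite subr_ge0 ler_pdivlMr; lra.
have : 2 `^ 0 <= 2 `^ (3 / p - 1) :> R by apply: ler_powR => //; lra.
rewrite powRr0 /D_const.
have := powR_ge0 8 p^-1; have := powR_ge0 (2 `^ (5 - p) + 2 `^ (2 - p)) p^-1.
by set x := powR _ _; set y := powR _ _; set z := powR _ _; lra.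
Qed.

End Final.

(** * Assembly of the dilation, the rounding and the polar part *)

Theorem theorem6p12 (R : realType) (gT : finGroupType) (G : {group gT})
    (n : nat) (p eps : R) (f : gT -> 'M[R[i]]_n)
    (n_gt0 : (0 < n)%N) (p_ge1 : 1 <= p) (p_le2 : p <= 2)
    (eps_gt0 : 0 < eps) (eps_le : eps <= 1 / 16)
    (f_eps : eps_representation G p eps f) :
  exists (m : nat) (rho : gT -> 'M[R[i]]_n),
    [/\ (1 - 4 * eps `^ p) * n%:R <= m%:R <= (1 - 4 * eps `^ p)^-1 * n%:R,
        partial_representation G m rho &
        forall x, x \in G ->
          schatten p (f x - rho x)
            <= (1 + 2 * D_const p + 8 `^ p^-1) * eps].
Proof.
case: f_eps => uf f_eps; set e := eps `^ p.
have n0 : 0 < n%:R :> R by rewrite ltr0n.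
have e0 : 0 <= e by exact: powR_ge0.
have e_le : e <= 1 / 16.
  by apply: le_trans (eps_le); apply: ge1r_powR => //; rewrite eps_gt0 /=; lra.
have defect x y : x \in G -> y \in G ->
    schatten_sum p (f x *m f y - f (x * y)%g) <= n%:R * e.
  move=> xG yG; rewrite -(schatten_le_sum _ n_gt0 p_ge1 (ltW eps_gt0)).
  exact: f_eps.
pose g x a := (f a) ^t* *m f (a * x)%g.
have ug x a : x \in G -> a \in G -> g x a \is unitarymx.
  move=> xG aG.
  exact: mul_unitarymx (unitarymx_adj_unitary (uf a aG)) (uf _ (groupM aG xG)).
have gE x a : a \in G -> f x - g x a = (f a) ^t* *m (f a *m f x - f (a * x)%g).
  by move=> aG; rewrite mulmxBr mulmxA (unitarymx_adj (uf a aG)) mul1mx.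
have cf a : a \in G -> contraction (f a).
  by move=> aG; exact: contraction_unitary (uf a aG).
pose P := @shift_mx R gT n; pose V := dilation_mx G f.
have uP x : P x \is unitarymx := shift_mx_unitary R n x.
have PM x y : P (x * y)%g = P x *m P y.
  by rewrite /P /shift_mx shift_permM perm_mxM.
have uV : V \is unitarymx := dilation_mx_unitary uf.
have phiE x : x \in G -> V *m P x *m V ^t* =
    (#|G|%:R^-1 : R)%:C *: \sum_(a in G) g x a.
  by move=> xG; rewrite [LHS](dilation_mxE f xG) fmorphV rmorph_nat.
have P1 : P 1%g = 1%:M by rewrite /P /shift_mx shift_perm1 perm_mx1.
clearbody P V.
(* The variance bound holds with [kappa] equal to [2 * (n%:R * e)], the 2 coming from the passage
   from p-th powers to squares. *)
have [m [W [uW PW le_m]]] : exists m (W : 'M_(m, _)), [/\ W \is unitarymx,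
    forall x, x \in G -> P x *m (W ^t* *m W) = W ^t* *m W *m P x &
    n%:R + m%:R - 2 * hs2 (V *m W ^t*) <= 2 * (2 * (n%:R * e))].
  apply: (spectral_rounding uP PM uV) => x xG; rewrite phiE //.
  apply: hs2_variance; [by move=> a; exact: (ug x a xG)|exact: uf xG|move=> a aG].
  rewrite gE //; apply: le_trans (hs2_mull _ (contraction_adj (cf a aG))) _.
  have le1 := hs2_le_schatten_sum p_ge1 p_le2
    (contractionM (cf a aG) (cf x xG)) (cf _ (groupM aG xG)).
  by apply: le_trans le1 _; rewrite ler_pM2l //; exact: defect.
pose T := V *m W ^t*; rewrite -/T in le_m.
have T_le_n : hs2 T <= n%:R.
  rewrite -(hs2_unitary uV); exact: (contraction_adj (contraction_unitary uW)).
have T_le_m : hs2 T <= m%:R.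
  rewrite -(hs2_unitary uW) -[hs2 W]hs2_adj.
  exact: hs2_mull (contraction_unitary uV).
have cT : contraction T := contractionM (contraction_unitary uV)
  (contraction_adj (contraction_unitary uW)).
have [A [B [t [uA uB pU t0 TE]]]] := polar_decomposition T.
pose P' x := W *m P x *m W ^t*.
have P'1 : P' 1%g = 1%:M.
  by rewrite /P' P1 mulmx1 (unitarymxP uW).
have P'M : {in G &, {morph P' : x y / (x * y)%g >-> x *m y}}.
  move=> x y xG yG; rewrite /P' PM.
  transitivity (W *m (P x *m (W ^t* *m W)) *m P y *m W ^t*).
    by rewrite (PW x xG) !mulmxA (unitarymxP uW) mul1mx.
  by rewrite !mulmxA.
have uP' x : x \in G -> P' x \is unitarymx.
  move=> xG; apply/unitarymxP; rewrite /P' !adjmxM trmxCK.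
  transitivity (W *m (P x *m (W ^t* *m W)) *m (P x) ^t* *m W ^t*).
    by rewrite !mulmxA.
  rewrite (PW x xG) !mulmxA (unitarymxP uW) mul1mx -(mulmxA W) (unitarymxP (uP x)).
  by rewrite mulmx1 (unitarymxP uW).
exists m, (fun x => (A *m B) *m P' x *m (A *m B) ^t*); split.
(* Since [hs2 T] is at most [n] and at most [m], [le_m] bounds both [m - n] and [n - m] by
   [4 * (n%:R * e)]; the upper bound then follows from [(1 + 4 * e) * (1 - 4 * e) <= 1]. *)
- move: le_m T_le_n T_le_m; move: (hs2 T) => h le_m h_n h_m.
  have ne0 : 0 <= n%:R * e by rewrite mulr_ge0 // ltW.
  have ne1 : n%:R * e <= n%:R * (1 / 16) by rewrite ler_pM2l.
  apply/andP; split; first by lra.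
  rewrite mulrC ler_pdivlMr; last by lra.
  have m_le : m%:R <= n%:R + 4 * (n%:R * e) by lra.
  move: n0 m_le; move: (n%:R : R) (m%:R : R) ne0 ne1 => u v ne0 ne1 u0 v_le.
  have le1 : v * (1 - 4 * e) <= (u + 4 * (u * e)) * (1 - 4 * e).
    by rewrite ler_wpM2r //; lra.
  apply: le_trans le1 _; rewrite -subr_ge0.
  have -> : u - (u + 4 * (u * e)) * (1 - 4 * e) = 16 * (u * e * e) by ring.
  by rewrite !mulr_ge0 // ltW.
- have rP' : mx_repr G P' by split.
  by exists (A *m B), (MxRepresentation rP'); split.
move=> x xG; have K9 := nine_le_const p_ge1 p_le2.
move: K9; set K := 1 + 2 * _ + _ => K9.
have K0 : 0 <= K by lra.
rewrite (schatten_le_sum _ n_gt0 p_ge1 (mulr_ge0 K0 (ltW eps_gt0))).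
(* The error is split in three: averaging, compression to the range of the projection, and polar
   part. *)
have -> : f x - A *m B *m P' x *m (A *m B) ^t* =
    (f x - V *m P x *m V ^t*) + (V *m P x *m V ^t* - T *m P' x *m T ^t*) +
    (T *m P' x *m T ^t* - A *m B *m P' x *m (A *m B) ^t*).
  by rewrite !addrA !subrK.
have le1 : schatten_sum p (f x - V *m P x *m V ^t*) <= n%:R * e.
  rewrite (phiE x xG).
  (* Weights and terms are extended by zero outside [G], because [schatten_sum_convex] sums over a
     whole finite type. *)
  pose w a : R := if a \in G then #|G|%:R^-1 else 0.
  have w0 a : 0 <= w a by rewrite /w; case: ifP => _ //; rewrite invr_ge0 ler0n.
  have wS : \sum_a w a = 1.
    rewrite /w -big_mkcond sumr_const -(mulr_natr (#|G|%:R^-1 : R) #|G|) mulVf //.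
    by rewrite gt_eqF ?card_groupR_gt0.
  pose F a := if a \in G then f x - g x a else 0.
  have -> : f x - (#|G|%:R^-1 : R)%:C *: \sum_(a in G) g x a =
            \sum_a (w a)%:C *: F a.
    transitivity (\sum_(a in G) (#|G|%:R^-1 : R)%:C *: (f x - g x a)).
      rewrite -scaler_sumr sumrB scalerBr sumr_const -(scaler_nat _ (f x)) scalerA.
      suff -> : (#|G|%:R^-1 : R)%:C * #|G|%:R = 1 by rewrite scale1r.
      by rewrite fmorphV rmorph_nat; exact: card_mulV.
    rewrite big_mkcond; apply: eq_bigr => a _; rewrite /w /F.
    by case: ifP => _ //; rewrite scaler0.
  apply: le_trans (schatten_sum_convex F p_ge1 w0 _) _; first by rewrite wS.
  have -> : n%:R * e = \sum_a w a * (n%:R * e) by rewrite -mulr_suml wS mul1r.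
  apply: ler_sum => a _.
  rewrite /w /F; case: ifP => aG; last by rewrite !mul0r.
  have c1 : contraction (1%:M : 'M[R[i]]_n).
    by apply: contraction_unitary; apply/unitarymxP; rewrite adjmx1 mul1mx.
  have := schatten_sumM_le (f a *m f x - f (a * x)%g) p_ge1 (contraction_adj (cf a aG)) c1.
  rewrite mulmx1 -(gE x a aG) => le_a; rewrite ler_wpM2l ?invr_ge0 ?ler0n //.
  exact: le_trans le_a (defect a x aG xG).
have le2 := schatten_sum_compression_le p_ge1 uV uW (uP x) (PW x xG).
have le3 := schatten_sum_polar_le p_ge1 uV uW uA uB (contraction_unitary (uP' x xG)) TE.
have le4 : \sum_i `|t i - 1| `^ p <= (minn n m)%:R - hs2 T.
  by have := polar_defect p_ge1 uA uB t0; rewrite -TE => /(_ cT).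
have le5 : 2 * (minn n m)%:R <= n%:R + m%:R :> R.
  by rewrite -natrD -natrM ler_nat mul2n -addnn leq_add // ?geq_minl ?geq_minr.
rewrite -/T -/(P' x) in le2 le3.
apply: le_trans (schatten_sumD _ _ p_ge1) _.
have := schatten_sumD (f x - V *m P x *m V ^t*)
  (V *m P x *m V ^t* - T *m P' x *m T ^t*) p_ge1.
move: le1 le2 le3; move: (schatten_sum p _) (schatten_sum p _) (schatten_sum p _).
move: (schatten_sum p _) => ab c b a le1 le2 le3 le12.
(* From [hs2 T <= m%:R], the defect [n%:R - hs2 T] is at most the left side of [le_m]. *)
have b_le : b <= 4 * (n%:R * e) by move: (hs2 T) le_m T_le_m le2 => *; lra.
(* The minimum of [n] and [m] is at most their mean, so this defect is at most half the left side of
   [le_m]. *)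
have c_le : c <= 2 `^ p * (2 * (n%:R * e)).
  apply: le_trans le3 _; rewrite ler_wpM2l ?powR_ge0 //; apply: le_trans le4 _.
  by move: (hs2 T) (minn n m)%:R le_m le5 => *; lra.
have K_le : 9 `^ p * e <= (K * eps) `^ p.
  have eps0 := ltW eps_gt0; rewrite /e -(powRM _ _ eps0) //.
  apply: ge0_ler_powR; rewrite ?nnegrE ?mulr_ge0 ?(le_trans ler01 p_ge1) //.
  by rewrite ler_wpM2r.
apply: le_trans (_ : n%:R * (9 `^ p * e) <= _); last by rewrite ler_pM2l.
have ne0 : 0 <= n%:R * e by rewrite mulr_ge0 // ltW.
have := sum4_const_le p_ge1; have := powR_ge0 2 p.
move: (2 `^ p) (9 `^ p) (n%:R * e) (le1) (b_le) (c_le) (ne0) (le12) (mulrCA n%:R (9 `^ p) e).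
move=> s r u a_u b_u c_u u0 ab_le -> s0 sr.
have s2 : 0 <= s / 2 by rewrite divr_ge0.
(* With [s] the p-th power of 2 and [u = n%:R * e], the first two terms contribute [5 * u] and the
   third [4 * u], each times [s / 2]. *)
have abs : ab + c <= s / 2 * (9 * u).
  have : s / 2 * (a + b) <= s / 2 * (5 * u) by rewrite ler_wpM2l //; lra.
  by lra.
apply: le_trans (ler_wpM2l s2 abs) _.
by have := ler_wpM2r u0 sr; lra.
Qed.
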